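(* Let $k,l\in\mathbb{Z}$ with $k\geq 2$ and $l\geq 3$. Then the graph $\Gamma_{k,l}$ has no proper non-trivial definable reducts.
   Context: **The graph $\Gamma_{k,l}$.** Let $T_{k+1,l}$ be the (infinite) tree such that, in the bipartition of its vertices given by even distance, vertices in one part all have valency $k+1$ and vertices in the other part all have valency $l$. The graph $\Gamma_{k,l}$ has as vertex set the part of the bipartition consisting of the $l$-valent vertices of $T_{k+1,l}$, two vertices being adjacent in $\Gamma_{k,l}$ if and only if they are at distance two in $T_{k+1,l}$. (If $k+1=l$, either part may be taken.) The graph is viewed as a first-order structure whose language has a single binary relation symbol for adjacency. **Reducts.** ''$\emptyset$-definable'' means first-order definable without parameters. Let $\mathcal{N}$ be a structure with domain $N$. A *definable reduct* of $\mathcal{N}$ is a structure $\mathcal{N}'$ (in any first-order language) with domain $N$ such that every subset of $N^r$ (for any $r$) which is $\emptyset$-definable in $\mathcal{N}'$ is $\emptyset$-definable in $\mathcal{N}$. A definable reduct $\mathcal{N}'$ is *improper* if $\mathcal{N}$ is $\emptyset$-definable in $\mathcal{N}'$ (i.e. all relations of $\mathcal{N}$ are $\emptyset$-definable in $\mathcal{N}'$), and *proper* otherwise; it is *trivial* if $\mathcal{N}'$ is $\emptyset$-definable in the pure set $N$ (the structure with equality only), and *non-trivial* otherwise. *)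

(* Defs.v *)
From mathcomp Require Import all_boot.

Set Implicit Arguments.
Unset Strict Implicit.
Unset Printing Implicit Defensive.

Record language := Language {
  fsym : Type;
  farity : fsym -> nat;
  rsym : Type;
  rarity : rsym -> nat }.

Record structure (L : language) (D : Type) := Structure {
  interp_f : forall f : fsym L, (farity f).-tuple D -> D;
  interp_r : forall R : rsym L, (rarity R).-tuple D -> Prop }.

(* [term L n] and [formula L n] have their free variables among n variables.
   Binding is de Bruijn: under [FAll], variable [ord0] is the one just bound.
   The other connectives and the existential quantifier are classically
   expressible from the ones below. *)
Inductive term (L : language) (n : nat) : Type :=
| TVar (i : 'I_n)
| TApp (f : fsym L) (ts : 'I_(farity f) -> term L n).

Inductive formula (L : language) : nat -> Type :=
| FBot n : formula L n
| FEq n (t u : term L n) : formula L n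
| FRel n (R : rsym L) (ts : 'I_(rarity R) -> term L n) : formula L n
| FImp n (p q : formula L n) : formula L n
| FAll n (p : formula L n.+1) : formula L n.

Fixpoint eval (L : language) (D : Type) (M : structure L D) (n : nat)
    (v : n.-tuple D) (t : term L n) : D :=
  match t with
  | TVar i => tnth v i
  | TApp f ts => interp_f M (mktuple (fun i => eval M v (ts i)))
  end.

Fixpoint sat (L : language) (D : Type) (M : structure L D) (n : nat)
    (p : formula L n) : n.-tuple D -> Prop :=
  match p in formula _ m return m.-tuple D -> Prop with
  | FBot _ => fun _ => False
  | FEq _ t u => fun v => eval M v t = eval M v u
  | FRel _ R ts => fun v => interp_r M (mktuple (fun i => eval M v (ts i)))
  | FImp _ p q => fun v => sat M p v -> sat M q v
  | FAll _ p => fun v => forall a : D, sat M p (cons_tuple a v)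
  end.

Definition definable (L : language) (D : Type) (M : structure L D) (r : nat)
    (S : r.-tuple D -> Prop) : Prop :=
  exists p : formula L r, forall v : r.-tuple D, S v <-> sat M p v.

(* A function symbol counts through its graph, the value coming first. *)
Definition definable_in (L L' : language) (D : Type)
    (M : structure L D) (M' : structure L' D) : Prop :=
  (forall R : rsym L, definable M' (@interp_r L D M R)) /\
  (forall f : fsym L,
     definable M' (fun v : (farity f).+1.-tuple D =>
                     thead v = interp_f M (behead_tuple v))).

Definition definable_reduct (L L' : language) (D : Type)
    (M : structure L D) (M' : structure L' D) : Prop :=
  forall (r : nat) (S : r.-tuple D -> Prop), definable M' S -> definable M S.

Definition improper (L L' : language) (D : Type)
    (M : structure L D) (M' : structure L' D) : Prop :=
  definable_in M M'.

Definition pure_language : language :=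
  @Language void (fun _ => 0) void (fun _ => 0).

Definition pure_set (D : Type) : structure pure_language D :=
  @Structure pure_language D (fun f => match f with end)
                             (fun R => match R with end).

Definition trivial_structure (L' : language) (D : Type)
    (M' : structure L' D) : Prop :=
  definable_in M' (pure_set D).

Definition graph_language : language :=
  @Language void (fun _ => 0) unit (fun _ => 2).

Definition graph_structure (D : Type) (adj : D -> D -> Prop) :
    structure graph_language D :=
  @Structure graph_language D (fun f => match f with end)
    (fun _ (v : 2.-tuple D) => adj (tnth v ord0) (tnth v ord_max)).

Record is_tree (V : eqType) (e : rel V) : Prop := IsTree {
  tree_inhabited : exists x : V, True;
  tree_sym : symmetric e;
  tree_irrefl : irreflexive e;
  tree_connected : forall x y : V, exists2 p, path e x p & last x p = y;
  tree_acyclic : forall c : seq V, ucycle e c -> size c <= 2 }.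

Definition valency (V : eqType) (e : rel V) (x : V) (d : nat) : Prop :=
  exists s : seq V, [/\ uniq s, size s = d & forall y, (y \in s) = e x y].

Definition at_distance (V : eqType) (e : rel V) (x y : V) (n : nat) : Prop :=
  (exists p, [/\ path e x p, last x p = y & size p = n]) /\
  (forall p, path e x p -> last x p = y -> n <= size p).

(* T_{k+1,l} is determined up to isomorphism by the following description, with
   [A] the distinguished part, made of l-valent vertices; if k+1 = l, [A] may
   be either of the two parts. *)
Record is_biregular_tree (k l : nat) (V : eqType) (e : rel V) (A : pred V) :
    Prop := IsBiregularTree {
  biregular_tree : is_tree e;
  biregular_parts : forall (x y : V) (n : nat),
    at_distance e x y n -> (A x = A y <-> ~~ odd n);
  biregular_in : forall x : V, A x -> valency e x l;
  biregular_out : forall x : V, ~~ A x -> valency e x k.+1 }.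

Definition Gamma (V : eqType) (e : rel V) (A : pred V) :
    structure graph_language {x : V | A x} :=
  graph_structure (fun x y : {x : V | A x} => at_distance e (val x) (val y) 2).

(* Main.v *)
From Stdlib Require Import Classical ClassicalEpsilon.
Require Import Defs.
From mathcomp Require Import all_boot.
From mathcomp Require Import zify.

Set Implicit Arguments.
Unset Strict Implicit.
Unset Printing Implicit Defensive.

(** Write [dist] for the distance of the tree and call points the vertices of
    Gamma, that is, the vertices in [A]. The distance between two points is
    even, twice their distance in Gamma, and adjacency means distance 2.

    What Gamma can define. In a tree where the valency depends only on the part,
    a finite partial isometry that respects the parts extends to any further
    vertex ([extend_isometric]). A back-and-forth argument on
    distances cut off at a radius then shows that every formula has a radius R
    such that its truth depends only on the distances below R between its
    arguments ([sat_agree]). In particular a definable binary relation depends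
    only on the distance, and it is constant beyond some distance.

    A reduct whose binary relations cannot tell two pairs of distinct points
    apart is trivial. By induction on the arity, all its relations depend only
    on which arguments are equal. Take a relation of arity n + 1 at least 3; after
    passing to the complement, it is false on tuples of points far apart. Counting
    points with a first-order formula expresses that a coordinate may be chosen
    generically, and by the induction hypothesis the outcome does not
    depend on the other coordinates; so no tuple of distinct points in the
    relation has an isolated coordinate ([isolated_coordinate]). If there were a
    tuple of distinct points in the relation, its first coordinate could be
    forgotten, and by induction any n distinct points would extend to a tuple in
    the relation. For n far apart points the new coordinate is close to at most
    one of them, so some coordinate is isolated ([false_if_spread_false]). Hence
    the relation depends only on the equalities between its arguments
    ([indiscernible_step], [definable_pure]).

    Otherwise the reduct defines a binary relation E, empty on the
    diagonal and nonempty, with a largest distance M. Having exactly one z with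
    E x z and E z y holds at distance 2M, where z must be the midpoint, and fails
    at distance at most 2M - 4, where the midpoint has other branches. At
    distance 2M - 2 it fails as soon as M - 2 is a distance of E, since the two
    points at distances M and M - 2 from the ends are then both
    witnesses. So one or two rounds of this construction give a relation that
    holds exactly at one distance N, with N at least 4
    ([nontrivial_exact_distance]). Finally let C x y be the set of points at
    distance N from both x and y. For x <> y, the pair is adjacent if and only
    if C x y is contained in C x w for no w other than x and y
    ([adjacent_iff]): if x and y are not adjacent, take for w a point adjacent to
    x in the direction of y, and if they are adjacent, a branch at the vertex
    between them separates C x y from C x w. This defines adjacency in the
    reduct, which is therefore improper.

    The bounds on k and l enter as the existence of three neighbours at every
    vertex ([three_neighbours]). *)

(** * Closure properties of definable relations *)

Section Definability.
Variables (L : language) (D : eqType) (M : structure L D).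

Definition reindex n m (f : 'I_n -> 'I_m) (v : m.-tuple D) : n.-tuple D :=
  [tuple tnth v (f i) | i < n].

Definition rename_under_binder n m (f : 'I_n -> 'I_m) (i : 'I_n.+1) : 'I_m.+1 :=
  if unlift ord0 i is Some j then lift ord0 (f j) else ord0.

Fixpoint rename_term n m (f : 'I_n -> 'I_m) (t : term L n) : term L m :=
  match t with
  | TVar i => TVar L (f i)
  | TApp g ts => TApp (fun i => rename_term f (ts i))
  end.

Fixpoint rename_formula n (p : formula L n) : forall m, ('I_n -> 'I_m) -> formula L m :=
  match p in formula _ n return forall m, ('I_n -> 'I_m) -> formula L m with
  | FBot _ => fun m _ => FBot L m
  | FEq _ t u => fun m f => FEq (rename_term f t) (rename_term f u)
  | FRel _ R ts => fun m f => FRel (fun i => rename_term f (ts i))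
  | FImp _ p q => fun m f => FImp (rename_formula p f) (rename_formula q f)
  | FAll _ p => fun m f => FAll (rename_formula p (rename_under_binder f))
  end.

Lemma tnth_cons0 n a (v : n.-tuple D) : tnth (cons_tuple a v) ord0 = a.
Proof. by []. Qed.

Lemma tnth_consS n a (v : n.-tuple D) j :
  tnth (cons_tuple a v) (lift ord0 j) = tnth v j.
Proof. by rewrite tnthS. Qed.

Lemma reindex_cons n m (f : 'I_n -> 'I_m) a (v : m.-tuple D) :
  cons_tuple a (reindex f v) = reindex (rename_under_binder f) (cons_tuple a v).
Proof.
apply: eq_from_tnth => i; rewrite tnth_mktuple /rename_under_binder.
case: unliftP => [j ->|->]; last by [].
by rewrite !tnth_consS tnth_mktuple.
Qed.

Lemma eval_rename n m (f : 'I_n -> 'I_m) (t : term L n) v :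
  eval M v (rename_term f t) = eval M (reindex f v) t.
Proof.
elim: t => [i|g ts IH] /=; first by rewrite tnth_mktuple.
by congr interp_f; apply: eq_from_tnth => i; rewrite !tnth_mktuple IH.
Qed.

Lemma sat_rename n (p : formula L n) m (f : 'I_n -> 'I_m) v :
  sat M (rename_formula p f) v <-> sat M p (reindex f v).
Proof.
elim: p m f v => {n} [n|n t u|n R ts|n p IHp q IHq|n p IH] m f v //=.
- by rewrite !eval_rename.
- rewrite (_ : mktuple _ = [tuple eval M (reindex f v) (ts i) | i < rarity R]) //.
  by apply: eq_from_tnth => i; rewrite !tnth_mktuple eval_rename.
- by rewrite IHp IHq.
- by split=> H a; have := H a; rewrite IH -reindex_cons.
Qed.

Lemma definable_ext n (S S' : n.-tuple D -> Prop) :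
  definable M S -> (forall v, S v <-> S' v) -> definable M S'.
Proof. by move=> [p Hp] SS'; exists p => v; rewrite -SS'. Qed.

Lemma definable_reindex n m (f : 'I_n -> 'I_m) (S : n.-tuple D -> Prop) :
  definable M S -> definable M (fun v => S (reindex f v)).
Proof. by case=> p Hp; exists (rename_formula p f) => v; rewrite sat_rename. Qed.

Lemma definable_imp n (S S' : n.-tuple D -> Prop) :
  definable M S -> definable M S' -> definable M (fun v => S v -> S' v).
Proof. by move=> [p Hp] [q Hq]; exists (FImp p q) => v /=; rewrite Hp Hq. Qed.

Lemma definable_const n (Q : Prop) : definable M (fun _ : n.-tuple D => Q).
Proof.
case: (classic Q) => HQ; last by exists (FBot L n) => v /=.
by exists (FImp (FBot L n) (FBot L n)) => v /=.
Qed.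

Lemma definable_not n (S : n.-tuple D -> Prop) :
  definable M S -> definable M (fun v => ~ S v).
Proof. by move=> dS; apply: definable_imp => //; apply: definable_const. Qed.

Lemma definable_and n (S S' : n.-tuple D -> Prop) :
  definable M S -> definable M S' -> definable M (fun v => S v /\ S' v).
Proof.
move=> dS dS'.
apply: definable_ext (definable_not (definable_imp dS (definable_not dS'))) _ => v.
by split=> [h|[h h'] /(_ h)] //; apply: NNPP; tauto.
Qed.

Lemma definable_all n (S : D -> n.-tuple D -> Prop) :
  definable M (fun u : n.+1.-tuple D => S (thead u) (behead_tuple u)) ->
  definable M (fun v => forall a, S a v).
Proof.
case=> p Hp; exists (FAll p) => v /=; split=> H a.
  by apply/Hp; rewrite theadE /=; have := H a; congr S; apply: val_inj.
by move/Hp: (H a); rewrite theadE; congr S; apply: val_inj.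
Qed.

Lemma definable_ex n (S : D -> n.-tuple D -> Prop) :
  definable M (fun u : n.+1.-tuple D => S (thead u) (behead_tuple u)) ->
  definable M (fun v => exists a, S a v).
Proof.
move=> dS.
apply: definable_ext (definable_not (definable_all (S := fun a v => ~ S a v) _)) _.
  exact: definable_not.
by move=> v; split=> [/not_all_not_ex|[a Sa] /(_ a)].
Qed.

Lemma definable_fin (I : finType) n (S : I -> n.-tuple D -> Prop) :
  (forall i, definable M (S i)) -> definable M (fun v => forall i, S i v).
Proof.
move=> dS; suff H (s : seq I) : definable M (fun v => forall i : I, i \in s -> S i v).
  by apply: definable_ext (H (enum I)) _ => v; split=> h i; [apply: h; rewrite mem_enum|].
elim: s => [|j s IH].
  by apply: definable_ext (definable_const n True) _ => v; split.
apply: definable_ext (definable_and (dS j) IH) _ => v; split.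
  by move=> [h1 h2] i; rewrite inE => /orP[/eqP->|/h2].
by move=> h; split=> [|i is_]; apply: h; rewrite inE ?eqxx ?is_ ?orbT.
Qed.

(** Recognising coordinates up to equality of functions lets the definability
    proofs follow the shape of a predicate on points, without de Bruijn indices. *)
Definition variable n (x : n.-tuple D -> D) : Prop :=
  exists i, forall v, x v = tnth v i.

Lemma variable_tnth n (i : 'I_n) : variable (fun v => tnth v i).
Proof. by exists i. Qed.

Lemma variable_thead n : variable (fun v : n.+1.-tuple D => thead v).
Proof. by exists ord0. Qed.

Lemma variable_behead n (x : n.-tuple D -> D) :
  variable x -> variable (fun v : n.+1.-tuple D => x (behead_tuple v)).
Proof.
case=> i Hi; exists (lift ord0 i) => v; rewrite Hi tnth_behead.
by congr tnth; apply: val_inj; rewrite /= inordK ?ltnS.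
Qed.

Lemma definable_eq n (x y : n.-tuple D -> D) :
  variable x -> variable y -> definable M (fun v => x v = y v).
Proof.
by case=> i Hi [j Hj]; exists (FEq (TVar L i) (TVar L j)) => v /=; rewrite Hi Hj.
Qed.

Definition definable2 (E : D -> D -> Prop) : Prop :=
  definable M (fun v : 2.-tuple D => E (tnth v ord0) (tnth v ord_max)).

Lemma definable2_app E n (x y : n.-tuple D -> D) :
  definable2 E -> variable x -> variable y -> definable M (fun v => E (x v) (y v)).
Proof.
move=> dE [i Hi] [j Hj].
apply: definable_ext (definable_reindex (fun a : 'I_2 => if a == ord0 then i else j) dE) _.
by move=> v; rewrite !tnth_mktuple /= Hi Hj.
Qed.

(** The recursion adds one quantifier at a time, which keeps it first-order. *)
Fixpoint atleast (K : nat) (P : D -> Prop) : Prop :=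
  if K is K'.+1 then exists y, P y /\ atleast K' (fun z => z <> y /\ P z) else True.

Lemma definable_atleast K n (S : D -> n.-tuple D -> Prop) :
  definable M (fun u : n.+1.-tuple D => S (thead u) (behead_tuple u)) ->
  definable M (fun v => atleast K (S^~ v)).
Proof.
elim: K n S => [|K IH] n S dS /=; first exact: definable_const.
apply/definable_ex/definable_and => //.
apply: (IH _ (fun z u => z <> thead u /\ S z (behead_tuple u))).
apply: definable_and; first apply/definable_not/definable_eq.
- exact: variable_thead.
- exact/variable_behead/variable_thead.
pose f (i : 'I_n.+1) : 'I_n.+2 := if unlift ord0 i is Some j then lift ord0 (lift ord0 j) else ord0.
apply: definable_ext (definable_reindex f dS) _ => v.
suff [-> ->] : thead (reindex f v) = thead v /\
   behead_tuple (reindex f v) = behead_tuple (behead_tuple v) by [].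
split; first by rewrite /thead tnth_mktuple /f unlift_none.
apply: eq_from_tnth => i.
have bt m (w : m.+1.-tuple D) (j : 'I_m) : tnth (behead_tuple w) j = tnth w (lift ord0 j).
  by rewrite tnth_behead; congr tnth; apply: val_inj; rewrite /= inordK ?ltnS.
by rewrite !bt tnth_mktuple /f liftK.
Qed.

Lemma atleastP K (P : D -> Prop) :
  atleast K P <-> exists s : seq D, [/\ uniq s, size s = K & forall y, y \in s -> P y].
Proof.
elim: K P => [|K IH] P /=; first by split=> // _; exists [::].
split.
  move=> [y [Py /IH[s [us ss Ps]]]]; exists (y :: s); split=> /=; last 1 first.
  - by move=> z; rewrite inE => /orP[/eqP->//|/Ps[]].
  - by rewrite us andbT; apply/negP=> /Ps[].
  - by rewrite ss.
move=> [[|y s] [//= /andP[ys us] [ss] Ps]]; exists y; split; first by apply: Ps; rewrite inE eqxx.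
apply/IH; exists s; split=> // z zs; split; last by apply: Ps; rewrite inE zs orbT.
by move=> zy; rewrite -zy zs in ys.
Qed.

End Definability.

(* A proof term fixes the projection; applying [variable_behead] to an open goal
   would ask for a second-order unification. *)
Ltac projection := first
  [ exact (variable_thead _ _) | exact (variable_tnth _ _)
  | exact (variable_behead (variable_thead _ _)) | exact (variable_behead (variable_tnth _ _))
  | exact (variable_behead (variable_behead (variable_thead _ _)))
  | exact (variable_behead (variable_behead (variable_tnth _ _))) ].


(** * The metric of the tree *)

Section Tree.
Variables (k l : nat) (hk : 2 <= k) (hl : 3 <= l).
Variables (V : eqType) (e : rel V) (A : pred V) (hT : is_biregular_tree k l e A).

Let hTree := biregular_tree hT.
Let e_sym : symmetric e := tree_sym hTree.

(** The default 0 is never reached: the tree is connected, hence [dist_spec]. *)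
Definition dist (x y : V) : nat := epsilon (inhabits 0) (at_distance e x y).

Lemma dist_spec x y : at_distance e x y (dist x y).
Proof.
apply: epsilon_spec.
have [p pp lp] := tree_connected hTree x y.
have [n Hn] : exists n, exists p, [/\ path e x p, last x p = y & size p = n].
  by exists (size p), p.
elim/ltn_ind: n Hn => n IH Hn.
case: (classic (exists2 m, m < n & exists p, [/\ path e x p, last x p = y & size p = m])).
  by move=> [m mn Hm]; apply: IH mn Hm.
move=> H; exists n; split=> // q pq lq; rewrite leqNgt; apply/negP => sq.
by apply: H; exists (size q) => //; exists q.
Qed.

Lemma dist_le x p : path e x p -> dist x (last x p) <= size p.
Proof. by move=> pp; apply: (proj2 (dist_spec _ _)). Qed.

Lemma at_distanceE x y n : at_distance e x y n <-> dist x y = n.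
Proof.
split=> [[[p [pp lp sp]] H]|<-]; last exact: dist_spec.
have [[q [pq lq sq]] H'] := dist_spec x y.
by apply/eqP; rewrite eqn_leq -{1}sp H' //= -sq H.
Qed.

Lemma distxx x : dist x x = 0.
Proof. by apply/eqP; rewrite -leqn0 (@dist_le x [::]). Qed.

Lemma dist_triangle y x z : dist x z <= dist x y + dist y z.
Proof.
have [[p [pp lp <-]] _] := dist_spec x y.
have [[q [pq lq <-]] _] := dist_spec y z.
have := @dist_le x (p ++ q).
by rewrite cat_path last_cat lp lq size_cat pp pq => /(_ isT).
Qed.

Lemma distC x y : dist x y = dist y x.
Proof.
suff H a b : dist a b <= dist b a by apply/eqP; rewrite eqn_leq !H.
have [[p [pp lp <-]] _] := dist_spec b a.
have := @dist_le a (rev (belast b p)).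
have la : last a (rev (belast b p)) = b.
  by case: p {pp} lp => [|c p] //=; rewrite rev_cons last_rcons.
rewrite la size_rev size_belast; apply.
by rewrite -lp rev_path (eq_path (e' := e)) // => u v; rewrite e_sym.
Qed.

Lemma dist_eq0 x y : dist x y = 0 -> x = y.
Proof. by have [[[|z p] [pp lp <-]] _] := dist_spec x y. Qed.

Lemma dist_edge x y : e x y -> dist x y = 1.
Proof.
move=> exy; have := @dist_le x [:: y]; rewrite /= exy => /(_ isT).
case E: (dist x y) => [|[|]] // _.
by move: exy; rewrite (dist_eq0 E) (tree_irrefl hTree).
Qed.

Lemma geodesic_step x y n : dist x y = n.+1 -> exists2 u, e x u & dist u y = n.
Proof.
move=> H; have [[[|u p] [/= pp lp sp]] _] := dist_spec x y; first by rewrite H in sp.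
case/andP: pp => exu pp; exists u => //.
have := dist_le pp; rewrite lp; have := dist_triangle u x y.
by rewrite (dist_edge exu); lia.
Qed.

Lemma edge_dist1 x y : dist x y = 1 -> e x y.
Proof. by move=> /geodesic_step[u xu /dist_eq0 <-]. Qed.

Lemma part_dist x y : A x = A y <-> ~~ odd (dist x y).
Proof. by have := @biregular_parts _ _ _ _ _ hT x y _ (dist_spec x y). Qed.

Lemma part_edge x y : e x y -> A y = ~~ A x.
Proof.
move=> exy; have := part_dist x y; rewrite (dist_edge exy) /=.
by case: (A x) (A y) => -[] // [] H _; have := H erefl.
Qed.

(** The parts forbid that two neighbours are equally far from [y]. *)
Lemma edge_step x u y : e x u ->
  dist u y = (dist x y).+1 \/ dist x y = (dist u y).+1.
Proof.
move=> exu; have := dist_triangle u x y; have := dist_triangle x u y.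
rewrite (distC u x) (dist_edge exu).
suff: dist u y <> dist x y by lia.
move=> E; have := part_dist x y; have := part_dist u y.
rewrite E (part_edge exu); case: (~~ odd _); case: (A x) (A y) => -[]; intuition discriminate.
Qed.

(** Two such neighbours are joined through [y] by a walk that avoids [x], and a
    shortest part of that walk closes up to a cycle through [x]. *)
Lemma toward_uniq x y u u' : e x u -> e x u' ->
  dist x y = (dist u y).+1 -> dist x y = (dist u' y).+1 -> u = u'.
Proof.
have avoid w : dist x y = (dist w y).+1 ->
    exists p, [/\ path e w p, last w p = y & x \notin w :: p].
  move=> Hw; have [[p [pp lp sp]] _] := dist_spec w y; exists p; split=> //.
  apply/negP => xp; case/splitPl: xp pp lp sp => p1 p2 E.
  rewrite cat_path last_cat size_cat E => /andP[_ p2p] lp sp.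
  by have := dist_le p2p; rewrite lp; lia.
move=> xu xu' /avoid[p [pp lp xp]] /avoid[q [pq lq xq]].
apply/eqP/negPn/negP => neq.
have : path e u (p ++ rev (belast u' q)).
  rewrite cat_path pp lp -lq rev_path.
  by rewrite (eq_path (e' := e)) // => a b; rewrite e_sym.
have : last u (p ++ rev (belast u' q)) = u'.
  rewrite last_cat lp; case: q {pq} lq xq => [|c q] //= _ _.
  by rewrite rev_cons last_rcons.
have : x \notin u :: (p ++ rev (belast u' q)).
  rewrite -cat_cons mem_cat negb_or xp mem_rev.
  by apply: contra xq => /mem_belast.
move: (p ++ _) => r xr lr pr.
move: lr; case: (shortenP pr) => r' pr' ur' sub lr.
have : size (x :: u :: r') <= 2.
  apply: (tree_acyclic hTree); rewrite /ucycle /=.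
  rewrite xu rcons_path pr' lr e_sym xu' /= -/(uniq (u :: r')) ur' andbT.
  apply: contra xr; rewrite !inE => /orP[->//|/sub ->]; exact: orbT.
by case: r' lr {pr' ur' sub} => //= lr; rewrite lr eqxx in neq.
Qed.

(** If the first edge of the geodesic from [x] to [y] does not lead to [z], then
    [x] lies between [y] and [z]. Pushing the edge towards [y] preserves the
    situation: by [toward_uniq], the only way back to [z] is the way it came. *)
Lemma dist_split x u y z : e x u -> dist x y = (dist u y).+1 ->
  dist u z = (dist x z).+1 -> dist y z = dist x y + dist x z.
Proof.
have [n] := ubnP (dist u y); elim: n x u => // n IH x u lt xu xy uz.
case E: (dist u y) => [|m]; first by rewrite xy E -(dist_eq0 E) uz.
have [u' uu' u'y] := geodesic_step E.
have [u'z|u'z] := edge_step z uu'; first by rewrite (IH u u'); lia.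
have xu' : x = u' by apply: (toward_uniq _ uu' uz u'z); rewrite e_sym.
by move: xy u'y; rewrite -xu'; lia.
Qed.

Lemma three_neighbours x u u' : exists a, [/\ e x a, a != u & a != u'].
Proof.
have [s [us ss es]] : exists s, [/\ uniq s, 2 < size s & forall y, (y \in s) = e x y].
  case: (boolP (A x)) => Ax.
    by have [s [? ss ?]] := biregular_in hT Ax; exists s; rewrite ss.
  by have [s [? ss ?]] := biregular_out hT Ax; exists s; rewrite ss.
apply: NNPP => H; have := uniq_leq_size (s2 := [:: u; u']) us.
suff sub : {subset s <= [:: u; u']} by move/(_ sub); rewrite leqNgt ss.
move=> a; rewrite es !inE => ea; apply/negPn/negP; rewrite negb_or => /andP[? ?].
by apply: H; exists a.
Qed.

Lemma toward_or z x : exists u, forall a, e z a -> a != u -> dist a x = (dist z x).+1.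
Proof.
case E: (dist z x) => [|n].
  by exists z => a za _; rewrite (dist_eq0 E) in za *; rewrite distC (dist_edge za).
have [u zu ux] := geodesic_step E; exists u => a za /eqP nau.
have [->|ax] := edge_step x za; first by rewrite E.
by case: nau; apply: toward_uniq za zu ax _; lia.
Qed.

(** Three neighbours are enough to leave two directions: at most one neighbour
    leads to [x] and at most one leads to [y]. *)
Lemma away2 z x y : exists a, [/\ e z a, dist a x = (dist z x).+1 & dist a y = (dist z y).+1].
Proof.
have [u Hu] := toward_or z x; have [u' Hu'] := toward_or z y.
by have [a [za au au']] := three_neighbours z u u'; exists a; split; auto.
Qed.

Lemma extend x y n : exists z, dist x z = dist x y + n /\ dist y z = n.
Proof.
elim: n => [|n [z [xz yz]]]; first by exists y; rewrite distxx addn0.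
have [a [_ ax ay]] := away2 z x y; exists a.
by rewrite distC ax (distC y) ay distC (distC z y); lia.
Qed.

Lemma between x y p q : dist x y = p + q -> exists z, dist x z = p /\ dist z y = q.
Proof.
elim: p x => [|p IH] x E; first by exists x; rewrite distxx.
have [u xu uy] := geodesic_step E; have [z [uz zy]] := IH u uy; exists z; split=> //.
have := dist_triangle u x z; have := dist_triangle z x y; rewrite (dist_edge xu); lia.
Qed.

Lemma between_uniq x y z z' : dist x y = dist x z + dist z y ->
  dist x z' = dist x z -> dist z' y = dist z y -> z = z'.
Proof.
move En: (dist x z) => n; elim: n x En => [|n IH] x En E E1 E2.
  by rewrite -(dist_eq0 En) -(dist_eq0 E1).
have [u xu uz] := geodesic_step En; have [u' xu' uz'] := geodesic_step E1.
have uy : dist x y = (dist u y).+1.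
  have := edge_step y xu; have := dist_triangle z u y; lia.
have uy' : dist x y = (dist u' y).+1.
  have := edge_step y xu'; have := dist_triangle z' u' y; lia.
have uu' := toward_uniq xu xu' uy uy'; rewrite -uu' in uz'.
apply: (IH u) => //; lia.
Qed.

(** * One-point extension of partial isometries *)

(** A finite partial map, given by its graph. *)
Definition isometric (s : seq (V * V)) : Prop := forall p q, p \in s -> q \in s ->
  dist p.1 q.1 = dist p.2 q.2 /\ A p.1 = A p.2.

Lemma isometric_cons s a b : isometric s -> A a = A b ->
  (forall p, p \in s -> dist a p.1 = dist b p.2) -> isometric ((a, b) :: s).
Proof.
move=> iso Aab Hab p q; rewrite !inE => /orP[/eqP->|ps] /orP[/eqP->|qs] //=.
- by rewrite !distxx.
- by rewrite Hab.
- by rewrite distC Hab // distC; split=> //; case: (iso _ _ ps ps).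
- exact: iso.
Qed.

(** If the new vertex [a] starts a geodesic from [x] to a vertex of the domain,
    follow the corresponding geodesic from [y]. Otherwise [a] witnesses that the
    vertices of the domain leave a direction free at [x]. By [dist_split] two
    vertices lie in the same direction exactly when their distance is less than
    the sum of their distances to [x], so the occupied directions correspond at
    [x] and [y]; as the valencies agree, a direction is free at [y] too. *)
Lemma extend_edge s x y a : isometric s -> (x, y) \in s -> e x a ->
  exists b, isometric ((a, b) :: s).
Proof.
move=> iso xys xa.
have [_ /= Axy] := iso _ _ xys xys.
suff [b yb Hb] : exists2 b, e y b &
    forall p, p \in s -> (dist x p.1 = (dist a p.1).+1 <-> dist y p.2 = (dist b p.2).+1).
  exists b; apply: isometric_cons => //.
    by rewrite (part_edge xa) (part_edge yb) Axy.
  move=> p ps; have [/= E _] := iso _ _ xys ps; have := Hb p ps.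
  have := edge_step p.1 xa; have := edge_step p.2 yb; lia.
case: (classic (exists2 p, p \in s & dist x p.1 = (dist a p.1).+1)).
  move=> [p ps ap]; have [/= Exp _] := iso _ _ xys ps.
  have [b yb bp] := geodesic_step (etrans (esym Exp) ap); exists b => // q qs.
  have [/= Exq _] := iso _ _ xys qs; have [/= Epq _] := iso _ _ ps qs.
  have := edge_step q.1 xa; have := edge_step q.2 yb.
  have := dist_triangle a p.1 q.1; have := dist_triangle b p.2 q.2.
  rewrite (distC p.1 a) (distC p.2 b).
  have := @dist_split x a p.1 q.1 xa ap; have := @dist_split y b p.2 q.2 yb; lia.
move=> Ha; suff [b yb Hb] : exists2 b, e y b &
    forall p, p \in s -> dist y p.2 <> (dist b p.2).+1.
  exists b => // p ps; split=> [ap|/(Hb p ps)//].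
  by case: Ha; exists p.
apply: NNPP => Hno.
(* Were every direction at [y] occupied, sending each of them to the matching
   direction at [x] would inject the neighbours of [y] into those of [x] other
   than [a]. *)
pose good b c := e x c /\ exists p, [/\ p \in s, dist y p.2 = (dist b p.2).+1 &
    dist x p.1 = (dist c p.1).+1].
have Hgood b : e y b -> exists c, good b c.
  move=> yb; apply: NNPP => H; apply: Hno; exists b => // p ps bp.
  have [/= Exp _] := iso _ _ xys ps.
  have [c xc cp] := geodesic_step (etrans Exp bp); apply: H; exists c; split=> //.
  by exists p; split=> //; lia.
pose f b := epsilon (inhabits x) (good b).
have fP b : e y b -> good b (f b) by move=> /Hgood H; apply: epsilon_spec.
have [d [[sx [usx ssx esx]] [sy [usy ssy esy]]]] : exists d, valency e x d /\ valency e y d.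
  case: (boolP (A x)) => Ax; [exists l|exists k.+1]; split.
  - exact (biregular_in hT Ax).
  - by rewrite Axy in Ax; exact (biregular_in hT Ax).
  - exact (biregular_out hT Ax).
  - by rewrite Axy in Ax; exact (biregular_out hT Ax).
have ax : a \in sx by rewrite esx.
have : size [seq f b | b <- sy] <= size (rem a sx).
  apply: uniq_leq_size.
    rewrite map_inj_in_uniq // => b b'; rewrite !esy => yb yb' Eff.
    have [_ [p [ps bp cp]]] := fP b yb; have [_ [p' [ps' bp' cp']]] := fP b' yb'.
    rewrite -Eff in cp'; have [/= Epp _] := iso _ _ ps ps'.
    have [/= Exp _] := iso _ _ xys ps; have [/= Exp' _] := iso _ _ xys ps'.
    have := dist_triangle (f b) p.1 p'.1; rewrite (distC p.1 (f b)).
    have [bp''|bp''] := edge_step p'.2 yb; last by move=> _; exact: toward_uniq yb yb' bp'' bp'.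
    move: (dist_split yb bp bp'') Epp Exp Exp' cp cp'; clear; lia.
  move=> c /mapP[b]; rewrite esy => yb ->; have [xf [p [ps bp cp]]] := fP b yb.
  rewrite mem_rem_uniq // inE esx xf andbT; apply/eqP => fa.
  by apply: Ha; exists p => //; rewrite -fa.
by rewrite size_map size_rem // ssx ssy; case: (d) ssx ax => [|n]; [case: (sx)|lia].
Qed.

Lemma extend_isometric s x y a : isometric s -> (x, y) \in s ->
  exists b, isometric ((a, b) :: s).
Proof.
move En: (dist x a) => n; elim: n x y s En => [|n IH] x y s En iso xys.
  exists y; rewrite -(dist_eq0 En) => p q; rewrite !inE.
  by move=> /orP[/eqP->|ps] /orP[/eqP->|qs]; apply: iso.
have [u xu ua] := geodesic_step En; have [u' iso'] := extend_edge iso xys xu.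
have [b Hb] := IH u u' _ ua iso' (mem_head _ _); exists b => p q ps qs.
by apply: Hb; rewrite !inE in ps qs *;
  [case/orP: ps|case/orP: qs] => ->; rewrite ?orbT.
Qed.

(** * Formulas see only truncated distances *)

Local Notation D := {x : V | A x}.

(** Distances between points are measured in the tree, so they are twice the
    distances in Gamma. *)
Definition pdist (a b : D) : nat := dist (sval a) (sval b).

Lemma pdistxx a : pdist a a = 0. Proof. exact: distxx. Qed.

Lemma pdistC a b : pdist a b = pdist b a. Proof. exact: distC. Qed.

Lemma pdist_triangle b a c : pdist a c <= pdist a b + pdist b c. Proof. exact: dist_triangle. Qed.

Lemma pdist_eq0 a b : pdist a b = 0 -> a = b. Proof. by move=> /dist_eq0 ab; apply: val_inj. Qed.

Lemma pdist_gt0 a b : (0 < pdist a b) = (a != b).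
Proof.
case: eqP => [->|ab]; first by rewrite pdistxx.
by case E: (pdist a b) => //; case: ab; apply: pdist_eq0.
Qed.

Lemma pdist_even a b : ~~ odd (pdist a b).
Proof. by apply/part_dist; rewrite (valP a) (valP b). Qed.

Lemma part_even_dist (a : D) x : ~~ odd (dist (sval a) x) -> A x.
Proof. by move=> /part_dist <-; apply: valP. Qed.

Lemma far_point (s : seq D) R : exists y, forall z, z \in s -> R <= pdist y z.
Proof.
have [x _] := tree_inhabited hTree.
have [B HB] : exists B, forall z, z \in s -> dist x (sval z) <= B.
  elim: s => [|z s [B HB]]; first by exists 0.
  exists (maxn B (dist x (sval z))) => u; rewrite inE => /orP[/eqP->|/HB zB].
    exact: leq_maxr.
  exact: leq_trans zB (leq_maxl _ _).
have [y [xy _]] := extend x x (R + B); rewrite distxx add0n in xy.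
have H (y' : D) : R + B <= dist x (sval y') -> exists y, forall z, z \in s -> R <= pdist y z.
  move=> xy'; exists y' => z /HB; have := dist_triangle (sval z) x (sval y').
  rewrite /pdist (distC (sval z)); lia.
case: (boolP (A y)) => Ay; first by apply: (H (exist _ y Ay)) => /=; lia.
have [a [ya ax _]] := away2 y x x; have Aa : A a by rewrite (part_edge ya).
by apply: (H (exist _ a Aa)); rewrite /= distC ax distC; lia.
Qed.

Lemma far_points K (s : seq D) R : exists t : seq D,
  [/\ uniq t, size t = K & forall y z, y \in t -> z \in s -> R <= pdist y z].
Proof.
elim: K => [|K [t [ut st tP]]]; first by exists [::].
have [y Hy] := far_point (t ++ s) (maxn 1 R); exists (y :: t); split=> /=.
- rewrite ut andbT; apply/negP => yt.
  by have := Hy y; rewrite mem_cat yt pdistxx => /(_ isT); lia.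
- by rewrite st.
- move=> u z; rewrite inE => /orP[/eqP->|] zs; last exact: tP.
  by have := Hy z; rewrite mem_cat zs orbT => /(_ isT); lia.
Qed.

Lemma far_tuple n R : exists v : n.-tuple D,
  forall i j, i != j -> R <= pdist (tnth v i) (tnth v j).
Proof.
elim: n => [|n [v Hv]]; first by exists [tuple] => -[].
have [y Hy] := far_point v R; exists (cons_tuple y v) => i j.
case: (unliftP ord0 i) => [i' ->|->]; case: (unliftP ord0 j) => [j' ->|->];
  rewrite ?tnth_cons0 ?tnth_consS //.
- by rewrite (inj_eq lift_inj); apply: Hv.
- by rewrite pdistC => _; apply/Hy/mem_tnth.
- by move=> _; apply/Hy/mem_tnth.
Qed.

(** All distances from [R] on are identified: with finitely many quantifiers a
    formula cannot tell large distances apart. *)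
Definition agree R n (v w : n.-tuple D) : Prop := forall i j,
  pdist (tnth v i) (tnth v j) = pdist (tnth w i) (tnth w j) \/
  R <= pdist (tnth v i) (tnth v j) /\ R <= pdist (tnth w i) (tnth w j).

Lemma agree_sym R n (v w : n.-tuple D) : agree R v w -> agree R w v.
Proof. by move=> H i j; have := H i j; lia. Qed.

Lemma agree_le R R' n (v w : n.-tuple D) : R <= R' -> agree R' v w -> agree R v w.
Proof. by move=> le H i j; have := H i j; lia. Qed.

Lemma agree_cons R n (v w : n.-tuple D) a b : agree R v w ->
  (forall i, pdist a (tnth v i) = pdist b (tnth w i) \/
     R <= pdist a (tnth v i) /\ R <= pdist b (tnth w i)) ->
  agree R (cons_tuple a v) (cons_tuple b w).
Proof.
move=> H Hab i j.
case: (unliftP ord0 i) => [i' ->|->]; case: (unliftP ord0 j) => [j' ->|->];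
  rewrite ?tnth_cons0 ?tnth_consS ?pdistxx; auto.
by rewrite pdistC (pdistC (tnth w i')).
Qed.

(** If [a] is far from all of [v], any far point will do. Otherwise [a] is close to
    some [i0], and the coordinates within 2R of [i0] are at mutual distances
    below 4R, so they form a true isometry, which extends to [a]. The remaining
    coordinates are at least 2R away from [i0] on both sides, hence at least R
    away from the new points. *)
Lemma agree_extend R n (v w : n.-tuple D) a : agree (4 * R) v w ->
  exists b, agree R (cons_tuple a v) (cons_tuple b w).
Proof.
move=> H; have H1 : agree R v w by apply: agree_le H; lia.
case: (boolP [forall i, R <= pdist a (tnth v i)]) => [/forallP far|].
  have [b Hb] := far_point w R; exists b; apply: agree_cons => // i; right.
  by rewrite far Hb // mem_tnth.
rewrite negb_forall => /existsP[i0]; rewrite -ltnNge => near.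
pose near0 := [pred i | pdist (tnth v i) (tnth v i0) < 2 * R].
pose s := [seq (sval (tnth v i), val (tnth w i)) | i <- enum near0].
have i0s : (sval (tnth v i0), val (tnth w i0)) \in s.
  by apply/mapP; exists i0; rewrite ?mem_enum // inE pdistxx; lia.
have iso : isometric s.
  move=> _ _ /mapP[i + ->] /mapP[j + ->]; rewrite !mem_enum !inE /= => Hi Hj.
  rewrite (valP (tnth v i)) (valP (tnth w i)); split=> //.
  rewrite -/(pdist _ _) -/(pdist (tnth w i) _).
  have := H i j; have := pdist_triangle (tnth v i0) (tnth v i) (tnth v j).
  by rewrite (pdistC (tnth v j)) in Hj; lia.
have [b isob] := extend_isometric (sval a) iso i0s.
have Hb i : i \in near0 -> dist (sval a) (sval (tnth v i)) = dist b (sval (tnth w i)).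
  move=> Hi; have [] // := isob (sval a, b) (sval (tnth v i), val (tnth w i)).
    exact: mem_head.
  by rewrite inE; apply/orP; right; apply/mapP; exists i; rewrite ?mem_enum.
have Ab : A b by have [_ /= <-] := isob _ _ (mem_head _ _) (mem_head _ _); apply: valP.
exists (exist _ b Ab); apply: agree_cons => // i.
case: (boolP (i \in near0)) => [/Hb|]; first by left.
rewrite inE -leqNgt => Hi; right.
have := H i i0.
have : pdist a (tnth v i0) = dist b (sval (tnth w i0)) by apply: Hb; rewrite inE pdistxx; lia.
rewrite -/(pdist (exist _ b Ab) _).
have := pdist_triangle (exist _ b Ab) (tnth w i) (tnth w i0).
have := pdist_triangle a (tnth v i) (tnth v i0).
rewrite (pdistC (tnth v i) a) (pdistC (tnth w i) (exist _ b Ab)); lia.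
Qed.

(** The radius 3 for atomic formulas makes the distance 2 visible; each quantifier
    multiplies the radius by 4. *)
Lemma sat_agree n (p : formula graph_language n) : exists2 R, 0 < R &
  forall v w, agree R v w -> sat (Gamma e A) p v <-> sat (Gamma e A) p w.
Proof.
have tv m (t : term graph_language m) : exists i, t = TVar graph_language i.
  by case: t => [i|[]]; exists i.
elim: n / p => [n|n t u|n [] ts|n p [R R0 IHp] q [R' R'0 IHq]|n p [R R0 IH]].
- by exists 1.
- have [[i ->] [j ->]] := (tv _ t, tv _ u); exists 1 => // v w /(_ i j) /= H.
  split=> E; apply: pdist_eq0; move: H; rewrite E pdistxx; lia.
- exists 3 => // v w H /=; rewrite !tnth_mktuple !at_distanceE.
  have [[i ->] [j ->]] := (tv _ (ts ord0), tv _ (ts ord_max)).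
  by have := H i j; rewrite /= /pdist; lia.
- exists (maxn R R') => [|v w H /=]; first lia.
  have [H1 H2] : agree R v w /\ agree R' v w by split; apply: agree_le H; lia.
  by rewrite (IHp _ _ H1) (IHq _ _ H2).
- exists (4 * R) => [|v w H /=]; first lia.
  have half v' w' : agree (4 * R) v' w' ->
      (forall a, sat (Gamma e A) p (cons_tuple a v')) ->
      forall a, sat (Gamma e A) p (cons_tuple a w').
    move=> H' Hs a; have [b Hb] := agree_extend a (agree_sym H').
    exact/(IH _ _ Hb)/Hs.
  by split; apply: half => //; apply: agree_sym.
Qed.

(** * Midpoints and spheres *)

Lemma ball_finite n x : exists s : seq V, forall y, dist x y <= n -> y \in s.
Proof.
elim: n x => [|n IH] x.
  by exists [:: x] => y; rewrite leqn0 inE => /eqP/dist_eq0 ->.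
have [t Ht] : exists t : seq V, forall u, e x u -> u \in t.
  by case: (boolP (A x)) => Ax;
    [have [t [_ _ Ht]] := biregular_in hT Ax|have [t [_ _ Ht]] := biregular_out hT Ax];
    exists t => u; rewrite Ht.
have [s Hs] : exists s : seq V, forall u, u \in t -> forall y, dist u y <= n -> y \in s.
  elim: t {Ht} => [|u t [s Hs]]; first by exists [::].
  have [s' Hs'] := IH u; exists (s ++ s') => a; rewrite inE => /orP[/eqP->|/Hs H] y ya.
    by rewrite mem_cat Hs' ?orbT.
  by rewrite mem_cat H.
exists (x :: s) => y; rewrite inE; case E: (dist x y) => [|m] ym.
  by rewrite (dist_eq0 E) eqxx.
have [u xu uy] := geodesic_step E; rewrite (Hs u) ?orbT ?Ht // uy; lia.
Qed.

(** The midpoint [p] has a neighbour [a] off the geodesic, and [a] has two further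
    neighbours: beyond these lie two points at distance [M] from both ends. *)
Lemma two_far_midpoints (x y : D) M : ~~ odd M -> pdist x y + 4 <= 2 * M ->
  exists z z', z <> z' /\ [/\ pdist x z = M, pdist z y = M, pdist x z' = M & pdist z' y = M].
Proof.
move=> Mev le; have := pdist_even x y; set j := pdist x y in le * => jev.
pose h := j./2; have jh : dist (sval x) (sval y) = h + h.
  by rewrite addnn -[LHS](odd_double_half) (negbTE jev).
have {}le : h + 2 <= M by rewrite /j /pdist jh in le; lia.
have [p [xp py]] := between jh; rewrite distC in py.
have [a [pa ax ay]] := away2 p (sval x) (sval y).
have beyond c : e a c -> dist p c = 2 -> exists z : D,
    [/\ dist c (sval z) = M - h - 2, dist a (sval z) = M - h - 1, pdist x z = M & pdist z y = M].
  move=> ac pc; have [z [pz cz]] := extend p c (M - h - 2).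
  have az : dist a z = M - h - 1.
    have := dist_triangle c a z; have := dist_triangle a p z.
    by rewrite (dist_edge pa) (dist_edge ac); lia.
  have paz : dist p z = (dist a z).+1 by lia.
  have xz : dist (sval x) z = M by rewrite distC (dist_split pa paz ax) (distC p (sval x)); lia.
  have yz : dist z (sval y) = M by rewrite (dist_split pa paz ay) (distC p (sval y)) py; lia.
  have Az : A z by apply: (@part_even_dist x); rewrite xz.
  by exists (exist _ z Az).
have [c [ac cp _]] := away2 a p p; rewrite (distC a) (dist_edge pa) distC in cp.
have [c' [ac' c'p c'c]] := away2 a p c; rewrite (distC a) (dist_edge pa) distC in c'p.
have [z [cz az xz zy]] := beyond c ac cp; have [z' [cz' az' xz' zy']] := beyond c' ac' c'p.
exists z, z'; split=> // zz'; rewrite -zz' in cz' az'.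
have cc' : c = c' by apply: (toward_uniq (y := sval z) ac ac'); lia.
by rewrite cc' distxx in c'c.
Qed.

(** Let [b] be the vertex between [x] and [y]. A vertex [z] at distance N - 1 from
    [b] in a third direction is at distance N from [x] and [y]. If [w] lies in
    the direction of [x] or [y], it is too far from [z]. If [w] is at most 3 away
    from [b] in a third direction, continue through [w] to get a [z] too close to
    it. If it is farther, branch off right after the first vertex [a] in its
    direction; then [z] is too far from [w]. *)
Lemma common_sphere_separates (x y w : D) N : ~~ odd N -> 4 <= N -> pdist x y = 2 ->
  w <> x -> w <> y -> exists z, [/\ pdist x z = N, pdist y z = N & pdist w z <> N].
Proof.
move=> Nev N4 xy wx wy.
suff [z [xz yz wz]] : exists z, [/\ dist (sval x) z = N, dist (sval y) z = N &
    dist (sval w) z <> N].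
  by have Az : A z; [apply: (@part_even_dist x); rewrite xz|exists (exist _ z Az)].
have [b xb by1] := geodesic_step xy; have {}by1 := edge_dist1 by1.
have bx : e b (sval x) by rewrite e_sym.
have Ab : A b = false by rewrite (part_edge xb) (valP x).
have bw_odd : odd (dist b (sval w)).
  apply/negPn/negP => /part_dist; by rewrite Ab (valP w).
have other u a z : e b u -> e b a -> u != a -> dist b z = (dist a z).+1 ->
    dist u z = (dist b z).+1.
  move=> bu ba /eqP ua az; have [//|uz] := edge_step z bu.
  by case: ua; apply: toward_uniq bu ba uz az.
have [m Eq] : exists m, dist b (sval w) = (m + m).+1.
  exists (dist b (sval w))./2.
  by rewrite addnn -[LHS](odd_double_half) bw_odd.
have [n En] : exists n, N = n + 4 by exists (N - 4); rewrite subnK.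
rewrite {}En in N4 Nev *; clear Nev N4 bw_odd xy.
have [a ba aw] := geodesic_step Eq.
case: (boolP (a \in [:: sval x; sval y])) => [axy|].
  have [c [bc cx cy]] := away2 b (sval x) (sval y).
  rewrite (dist_edge bx) in cx; rewrite (dist_edge by1) in cy.
  have [z [bz cz]] := extend b c (n + 2); rewrite (dist_edge bc) in bz.
  have bcz : dist b z = (dist c z).+1 by rewrite bz cz.
  have away u : e b u -> dist c u = 2 -> dist u z = n + 4.
    move=> bu cu; have uc : u != c by apply/eqP => uc; rewrite uc distxx in cu.
    by rewrite (other u c z) // bz; clear; lia.
  exists z; split; [exact: away|exact: away|].
  have az : dist a z = (dist b z).+1.
    rewrite bz; move: axy; rewrite !inE => /orP[]/eqP ->; rewrite (away _ _) //; clear; lia.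
  have m0 : m <> 0.
    move=> m0; rewrite m0 in aw; have := dist_eq0 aw => aw'.
    by move: axy; rewrite !inE aw' => /orP[]/eqP/val_inj.
  rewrite (dist_split ba _ az) Eq ?aw //; move: m0 bz; clear; lia.
rewrite !inE negb_or ![a == _]eq_sym => /andP[xa ya].
case: (leqP (dist b (sval w)) 3) => near.
  have [z [bz wz]] := extend b (sval w) (n + 2 - (m + m)).
  have baz : dist b z = (dist a z).+1.
    move: (dist_triangle (sval w) a z) (edge_step z ba) Eq aw near bz wz; clear; lia.
  exists z; rewrite wz (other _ _ _ bx ba xa baz) (other _ _ _ by1 ba ya baz).
  by move: Eq near bz wz; clear; split; lia.
have [c [ac cb cw]] := away2 a b (sval w).
rewrite (distC a) (dist_edge ba) distC in cb.
have [z [bz cz]] := extend b c n.+1.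
have ca : dist a c = 1 := dist_edge ac.
have baz : dist b z = (dist a z).+1.
  by move: (dist_triangle c a z) (edge_step z ba) bz cz cb ca; clear; lia.
exists z; rewrite (other _ _ _ bx ba xa baz) (other _ _ _ by1 ba ya baz).
have acz : dist a z = (dist c z).+1 by move: baz bz cz cb; clear; lia.
rewrite (distC (sval w) z) (dist_split ac acz cw).
by move: Eq near aw acz bz cz cb; clear; split; lia.
Qed.

(** Take [w] adjacent to [x], off the geodesic at its first vertex [b]. If [z]
    is at distance N from both [x] and [y], then it is in the direction of [b]
    from [x], otherwise it would be farther from [y] than from [x]; and from
    [b] it is not in the direction of [w], since then [y] would be at distance N
    from it only if [x] and [y] were adjacent. *)
Lemma common_sphere_nested (x y : D) N : x <> y -> pdist x y <> 2 ->
  exists w, [/\ w <> x, w <> y & forall z, pdist x z = N -> pdist y z = N -> pdist w z = N].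
Proof.
move=> /eqP; rewrite -pdist_gt0 => xy0 xy2.
have [j Ej] : exists j, pdist x y = j.+1 by case: (pdist x y) xy0 => // j _; exists j.
have [b xb by1] := geodesic_step Ej.
have [w [bw wx wy]] := away2 b (sval x) (sval y).
rewrite (distC b) (dist_edge xb) in wx.
have Aw : A w by rewrite (part_edge bw) (part_edge xb) (valP x).
exists (exist _ w Aw); split.
- by move=> E; rewrite -E /= distxx in wx.
- by move=> E; rewrite -E pdistC /pdist /= wx in xy2.
move=> z; rewrite /pdist /= => xz yz; rewrite /pdist in Ej xy2.
have [bz|bz] := edge_step (sval z) xb.
  have := @dist_split (sval x) b (sval y) (sval z) xb; lia.
have [wz|wz] := edge_step (sval z) bw; first lia.
have := @dist_split b w (sval z) (sval y) bw wz wy; rewrite distC; lia.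
Qed.

Lemma adjacent_iff (x y : D) N : ~~ odd N -> 4 <= N ->
  (pdist x y = 2 <-> x <> y /\ forall w, w <> x ->
     (forall z, pdist x z = N -> pdist y z = N -> pdist w z = N) -> w = y).
Proof.
move=> Nev N4; split.
  move=> xy; split=> [E|w wx sub]; first by rewrite E pdistxx in xy.
  apply: NNPP => wy; have [z [xz yz wz]] := common_sphere_separates Nev N4 xy wx wy.
  exact/wz/sub.
move=> [xy H]; apply: NNPP => xy2; have [w [wx wy sub]] := common_sphere_nested N xy xy2.
exact/wy/H.
Qed.

Definition unique_mid (E : D -> D -> Prop) (x y : D) : Prop :=
  exists z, (E x z /\ E z y) /\ forall z', E x z' /\ E z' y -> z' = z.

(** The distances below [M] are left open, because a round of [unique_mid] may or
    may not keep the distance just below the largest one. *)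
Definition has_radius (E : D -> D -> Prop) M : Prop :=
  (forall x y, pdist x y = M -> E x y) /\ (forall x y, E x y -> pdist x y <= M).

Lemma unique_mid_has_radius E M : ~~ odd M -> has_radius E M -> has_radius (unique_mid E) (2 * M).
Proof.
move=> Mev [EM leM]; split=> x y => [xy|[z [[/leM xz /leM zy] _]]]; last first.
  have := pdist_triangle z x y; lia.
have [z [xz zy]] : exists z, dist (sval x) z = M /\ dist z (sval y) = M.
  by apply: between; rewrite -/(pdist x y); lia.
have Az : A z by apply: (@part_even_dist x); rewrite xz.
exists (exist _ z Az); split; first by split; apply: EM.
move=> z' [/leM xz' /leM zy']; have := pdist_triangle z' x y => tr.
have Exy : pdist x y = pdist x z' + pdist z' y by lia.
have Exz : dist (sval x) z = pdist x z' by rewrite xz; lia.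
have Ezy : dist z (sval y) = pdist z' y by rewrite zy; lia.
by apply: val_inj; exact: (between_uniq Exy Exz Ezy).
Qed.

Lemma unique_mid_ge E M x y : ~~ odd M -> has_radius E M -> unique_mid E x y ->
  2 * M <= pdist x y + 2.
Proof.
move=> Mev [EM leM] [z [_ uniq]]; rewrite leqNgt; apply/negP => lt.
have [||a [b [ab [xa ay xb yb]]]] := @two_far_midpoints x y M => //.
  by have := pdist_even x y; lia.
have az : a = z by apply: uniq; split; apply: EM.
have bz : b = z by apply: uniq; split; apply: EM.
by apply: ab; rewrite az bz.
Qed.

(** At distance 2M - 2 the points at distances M and M - 2 from the ends, in either
    order, are both intermediate. *)
Lemma unique_mid_exact E M x y : ~~ odd M -> 2 < M -> has_radius E M ->
  (forall x y, pdist x y + 2 = M -> E x y) -> unique_mid E x y -> pdist x y = 2 * M.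
Proof.
move=> Mev M2 rE EM' um; have ge := unique_mid_ge Mev rE um.
have [_ /(_ _ _ um) le] := unique_mid_has_radius Mev rE.
case: (leqP (2 * M) (pdist x y)) => [|lt]; first lia.
have Exy : dist (sval x) (sval y) = 2 * M - 2.
  by have := pdist_even x y; rewrite /pdist in ge lt *; lia.
have mid p q : p + q = 2 * M - 2 -> ~~ odd p -> exists z : D, pdist x z = p /\ pdist z y = q.
  move=> pq pev; have [z [xz zy]] := between (etrans Exy (esym pq)).
  have Az : A z by apply: (@part_even_dist x); rewrite xz.
  by exists (exist _ z Az).
have [||z [xz zy]] := mid M (M - 2) => //; first lia.
have [||z' [xz' zy']] := mid (M - 2) M; [lia|lia|].
case: um => c [_ uniq]; case: rE => EM _.
have zc : z = c by apply: uniq; split; [apply: EM|apply: EM'; lia].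
have zc' : z' = c by apply: uniq; split; [apply: EM'; lia|apply: EM].
by move: xz; rewrite zc -zc' xz'; lia.
Qed.

(** * Reducts whose binary relations are trivial *)

Section Reduct.
Variables (L : language) (N : structure L D).
Hypothesis reduct : definable_reduct (Gamma e A) N.

Lemma definable_agree n (S : n.-tuple D -> Prop) : definable N S ->
  exists2 R, 0 < R & forall v w, agree R v w -> S v <-> S w.
Proof.
move=> /reduct[p Hp]; have [R R0 HR] := sat_agree p; exists R => // v w vw.
by rewrite !Hp; apply: HR.
Qed.

Lemma definable2_dist E x y x' y' : definable2 N E -> pdist x y = pdist x' y' -> E x y -> E x' y'.
Proof.
move=> /definable_agree[R _ HR] xy.
have /HR : agree R [tuple x; y] [tuple x'; y'].
  move=> i j; left; case: i j => [[|[|//]] i] [[|[|//]] j];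
  by rewrite !(tnth_nth x) /= ?pdistxx // pdistC xy pdistC.
by rewrite !(tnth_nth x) /= => ->.
Qed.

Lemma definable2_unique_mid E : definable2 N E -> definable2 N (unique_mid E).
Proof.
move=> dE; apply/definable_ex/definable_and; last apply/definable_all/definable_imp.
- by apply: definable_and; apply: definable2_app => //; projection.
- by apply: definable_and; apply: definable2_app => //; projection.
- by apply: definable_eq; projection.
Qed.

Definition spread R n (v : n.-tuple D) : Prop :=
  forall i j, i != j -> R <= pdist (tnth v i) (tnth v j).

Definition same_pattern n (v w : n.-tuple D) : Prop :=
  forall i j, tnth v i = tnth v j <-> tnth w i = tnth w j.

(** An implication suffices, since [same_pattern] is symmetric. *)
Definition indiscernible n : Prop := forall S : n.-tuple D -> Prop,
  definable N S -> forall v w, same_pattern v w -> S v -> S w.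

Lemma injective_same_pattern n (v w : n.-tuple D) :
  injective (tnth v) -> injective (tnth w) -> same_pattern v w.
Proof. by move=> iv iw i j; split=> [/iv->|/iw->]. Qed.

Lemma spread_injective R n (v : n.-tuple D) : 0 < R -> spread R v -> injective (tnth v).
Proof.
move=> R0 sv i j E; apply/eqP/negPn/negP => ij.
by have := sv i j ij; rewrite E pdistxx; lia.
Qed.

Lemma agree_spread R n (v w : n.-tuple D) : spread R v -> spread R w -> agree R v w.
Proof.
by move=> sv sw i j; case: (eqVneq i j) => [->|ij]; [left; rewrite !pdistxx|right; auto].
Qed.

Definition insert n (i : 'I_n.+1) (y : D) (u : n.-tuple D) : n.+1.-tuple D :=
  [tuple if unlift i j is Some j' then tnth u j' else y | j < n.+1].

Lemma tnth_insert n (i : 'I_n.+1) y u : tnth (insert i y u) i = y.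
Proof. by rewrite tnth_mktuple unlift_none. Qed.

Lemma tnth_insert_lift n (i : 'I_n.+1) y u j : tnth (insert i y u) (lift i j) = tnth u j.
Proof. by rewrite tnth_mktuple liftK. Qed.

Lemma definable_insert n (i : 'I_n.+1) (S : n.+1.-tuple D -> Prop) : definable N S ->
  definable N (fun w : n.+1.-tuple D => S (insert i (thead w) (behead_tuple w))).
Proof.
pose g j := if unlift i j is Some j' then lift ord0 j' else ord0.
move=> dS; apply: definable_ext (definable_reindex g dS) _ => w.
suff -> : reindex g w = insert i (thead w) (behead_tuple w) by [].
apply: eq_from_tnth => j; rewrite !tnth_mktuple /g; case: (unlift i j) => [j'|] //.
by rewrite tnth_behead; congr tnth; apply: val_inj; rewrite /= inordK ?ltnS.
Qed.

(** Let [Q w] say that more than |B| values of coordinate [i] complete [w] to a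
    tuple in [S], where [B] covers the balls of radius [R] around a spread tuple
    [u]. Then [Q u] fails, as any value outside [B] gives a spread tuple. But if [v]
    is in [S] with its coordinate [i] isolated, every far value of that
    coordinate is as good, so [Q] holds of the rest of [v], and by
    indiscernibility of [u]. *)
Lemma isolated_coordinate n (S : n.+1.-tuple D -> Prop) R : indiscernible n ->
  definable N S -> 0 < R -> (forall v w, agree R v w -> S v <-> S w) ->
  (forall v, spread R v -> ~ S v) ->
  forall i v, injective (tnth v) ->
    (forall j, j != i -> R <= pdist (tnth v i) (tnth v j)) -> ~ S v.
Proof.
move=> ind dS R0 aS noS i v iv far Sv.
have [u su] := far_tuple n R.
have [B HB] : exists B : seq V, forall y j, pdist y (tnth u j) <= R -> sval y \in B.
  suff [B HB] : exists B : seq V,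
      forall z, z \in tval u -> forall y, pdist y z <= R -> sval y \in B.
    by exists B => y j; apply: HB; apply: mem_tnth.
  elim: (tval u) => [|z s [B HB]]; first by exists [::].
  have [B' HB'] := ball_finite R (sval z); exists (B ++ B') => z'.
  rewrite inE => /orP[/eqP->|/HB H] y yz; rewrite mem_cat.
    by rewrite HB' ?orbT // distC.
  by rewrite H.
pose Q (w : n.-tuple D) := atleast (size B).+1 (fun y => S (insert i y w)).
have dQ : definable N Q by apply: definable_atleast; apply: definable_insert.
pose v' := reindex (lift i) v.
have iv' : injective (tnth v') by move=> j j'; rewrite !tnth_mktuple => /iv /lift_inj.
have Qv' : Q v'.
  have [t [ut st tP]] := far_points (size B).+1 v R.
  apply/atleastP; exists t; split=> // y yt; apply: (proj1 (aS v _ _) Sv) => j j'.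
  have yfar z : R <= pdist y (tnth v z) by apply: tP => //; apply: mem_tnth.
  case: (unliftP i j) => [a ->|->]; case: (unliftP i j') => [a' ->|->];
    rewrite ?tnth_insert ?tnth_insert_lift ?tnth_mktuple.
  - by left.
  - by right; split; rewrite pdistC; [apply: far; rewrite eq_sym neq_lift|].
  - by right; split; [apply: far; rewrite eq_sym neq_lift|].
  - by left; rewrite !pdistxx.
have /atleastP[t [ut st tP]] : Q u.
  by apply: ind dQ _ _ _ Qv'; apply: injective_same_pattern => //; apply: spread_injective su.
suff /uniq_leq_size : {subset [seq sval y | y <- t] <= B}.
  by rewrite (map_inj_uniq val_inj) size_map st ltnn => /(_ ut).
move=> _ /mapP[y yt ->]; apply: NNPP => yB; apply: (noS (insert i y u)); last exact: tP.
have yfar j : R <= pdist y (tnth u j).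
  by rewrite leqNgt; apply/negP => /ltnW /HB.
move=> j j'; case: (unliftP i j) => [a ->|->]; case: (unliftP i j') => [a' ->|->];
  rewrite ?tnth_insert ?tnth_insert_lift ?eqxx //.
- by rewrite (inj_eq lift_inj); apply: su.
- by rewrite pdistC.
Qed.

(** Forget the first coordinate: by indiscernibility every tuple of [n] distinct
    points extends to a tuple in [S] by a new point. For a tuple spread at 2R
    the new point is within R of at most one coordinate, and since [n >= 2]
    another one is isolated. *)
Lemma false_if_spread_false n (S : n.+1.-tuple D -> Prop) R : 2 <= n ->
  indiscernible n -> definable N S -> 0 < R ->
  (forall v w, agree R v w -> S v <-> S w) -> (forall v, spread R v -> ~ S v) ->
  forall v, injective (tnth v) -> ~ S v.
Proof.
move=> n2 ind dS R0 aS noS v iv Sv.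
pose P (u : n.-tuple D) := exists y, (forall j, y <> tnth u j) /\ S (cons_tuple y u).
have dP : definable N P.
  apply/definable_ex/definable_and.
    by apply: definable_fin => j; apply/definable_not/definable_eq; projection.
  by apply: definable_ext dS _ => w; rewrite {1}(tuple_eta w).
have Pv : P (behead_tuple v).
  exists (thead v); rewrite (tuple_eta v) in Sv; split=> // j E.
  have : tnth v ord0 = tnth v (lift ord0 j).
    by rewrite -[LHS]/(thead v) E [in RHS](tuple_eta v) tnthS.
  by move/iv => /eqP; rewrite (negbTE (neq_lift _ _)).
have [u su] := far_tuple n (2 * R).
have iu : injective (tnth u) by apply: spread_injective su; lia.
have ib : injective (tnth (behead_tuple v)).
  move=> j j' E; apply: (@lift_inj _ ord0); apply: iv.
  by rewrite (tuple_eta v) !tnthS.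
have [y [yu Syu]] := ind _ dP _ _ (injective_same_pattern ib iu) Pv.
have [j yj] : exists j, R <= pdist y (tnth u j).
  pose a := Ordinal (ltnW n2); pose b := Ordinal n2.
  have := su a b isT; have := pdist_triangle y (tnth u a) (tnth u b).
  rewrite (pdistC _ y) => tr ab.
  by case: (leqP R (pdist y (tnth u a))) => [|lt]; [exists a|exists b; lia].
apply: (isolated_coordinate ind dS R0 aS noS (i := lift ord0 j) _ _ Syu).
  move=> p p'; case: (unliftP ord0 p) => [q ->|->]; case: (unliftP ord0 p') => [q' ->|->];
    rewrite ?tnth_cons0 ?tnth_consS //.
  - by move/iu ->.
  - by move=> E; case: (yu q).
  - by move=> E; case: (yu q').
move=> p; rewrite tnth_consS; case: (unliftP ord0 p) => [q ->|-> _].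
  by rewrite (inj_eq lift_inj) tnth_consS => qj; rewrite pdistC; apply: leq_trans (su q j qj); lia.
by rewrite tnth_cons0 pdistC.
Qed.

Lemma indiscernible_step n : 2 <= n -> indiscernible n -> indiscernible n.+1.
Proof.
move=> n2 ind S dS v w vw Sv.
case: (classic (injective (tnth v))) => iv.
  have iw : injective (tnth w) by move=> i j /vw /iv.
  have [R R0 aS] := definable_agree dS; have [t st] := far_tuple n.+1 R.
  apply: NNPP => nSw; case: (classic (S t)) => St.
    have := @false_if_spread_false n (fun v => ~ S v) R n2 ind (definable_not dS) R0.
    move=> /(_ _ _ w iw nSw); apply.
      by move=> a b ab; have := aS a b ab; tauto.
    by move=> a sa; apply; apply/(aS _ _ (agree_spread sa st)).
  apply: (false_if_spread_false n2 ind dS R0 aS _ iv Sv) => a sa Sa.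
  exact/St/(aS _ _ (agree_spread st sa)).
have [i [j [ij vij]]] : exists i j, i != j /\ tnth v i = tnth v j.
  apply: NNPP => H; apply: iv => i j E; apply/eqP/negPn/negP => ij.
  by apply: H; exists i, j.
(* A repeated coordinate can be dropped, which lowers the arity. *)
have [j' Ej _] := unlift_some ij.
pose f x : 'I_n := if unlift i x is Some y then y else j'.
have Hf (u : n.+1.-tuple D) : tnth u i = tnth u j -> reindex f (reindex (lift i) u) = u.
  move=> E; apply: eq_from_tnth => x; rewrite !tnth_mktuple /f.
  by case: (unliftP i x) => [y ->|->]; rewrite // -Ej E.
rewrite -(Hf _ vij) in Sv; rewrite -(Hf _ (proj1 (vw i j) vij)).
apply: (ind _ (definable_reindex f dS) _ _ _ Sv) => a b.
by rewrite !tnth_mktuple; apply: vw.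
Qed.

Lemma indiscernible_all : indiscernible 2 -> forall n, indiscernible n.
Proof.
move=> H2; elim=> [|[|[|n]] IH] //; last exact: indiscernible_step.
  by move=> S _ v w _; rewrite (tuple0 v) (tuple0 w).
move=> S /definable_agree[R _ aS] v w _ /(aS v w); apply => i j.
by left; rewrite (ord1 i) (ord1 j) !pdistxx.
Qed.

(** There are finitely many equality types [f], so it suffices to exclude those
    that no tuple of [S] realises. *)
Lemma definable_pure n (S : n.-tuple D -> Prop) :
  (forall v w, same_pattern v w -> S v -> S w) -> definable (pure_set D) S.
Proof.
move=> HS.
pose type_is (f : {ffun 'I_n * 'I_n -> bool}) (v : n.-tuple D) :=
  forall p, tnth v p.1 = tnth v p.2 <-> f p.
have dtype f : definable (pure_set D) (type_is f).
  apply: definable_fin => p; case fp: (f p).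
    apply: definable_ext (definable_eq _ (variable_tnth _ p.1) (variable_tnth _ p.2)) _.
    by move=> v; split=> [E|[_ H]]; [split|apply: H].
  apply: definable_ext
    (definable_not (definable_eq _ (variable_tnth _ p.1) (variable_tnth _ p.2))) _.
  by move=> v; split=> [nE|[H _] /H]; first by split=> [/nE|].
pose good f := exists2 w, S w & type_is f w.
apply: definable_ext (definable_not (definable_fin
   (fun f => definable_imp (dtype f) (definable_const _ _ (~ good f))))) _ => v.
split=> [H|Sv H].
  apply: NNPP => nSv; apply: H => f fv [w Sw fw]; apply/nSv/(HS w) => // i j.
  by rewrite (fw (i, j)) (fv (i, j)).
pose f := [ffun p : 'I_n * 'I_n => tnth v p.1 == tnth v p.2].
have fv : type_is f v by move=> p; rewrite ffunE; split=> /eqP.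
by apply: (H f fv); exists v.
Qed.

Lemma indiscernible_trivial : (forall n, indiscernible n) -> trivial_structure N.
Proof.
move=> ind; have pure n S : definable N S -> definable (pure_set D) (S : n.-tuple D -> Prop).
  by move=> dS; apply: definable_pure; apply: ind.
split=> [R|f]; apply: pure.
  exists (FRel (fun i => TVar L i)) => v /=.
  by rewrite (_ : mktuple _ = v) //; apply: eq_from_tnth => i; rewrite tnth_mktuple.
exists (FEq (TVar L ord0) (TApp (fun i => TVar L (lift ord0 i)))) => v /=.
rewrite (_ : mktuple _ = behead_tuple v) //; apply: eq_from_tnth => i.
by rewrite tnth_mktuple [in LHS](tuple_eta v) tnthS.
Qed.

(** * Reducts with a nontrivial binary relation *)

(** A relation that separates two pairs of distinct points, or its complement, is
    false at large distances. *)
Lemma nontrivial_binary : ~ indiscernible 2 -> exists E R x y,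
  [/\ definable2 N E, E x y & forall x y, E x y -> 0 < pdist x y <= R].
Proof.
move=> H2.
have [S [dS [v [w [vw [Sv nSw]]]]]] : exists S : 2.-tuple D -> Prop,
    definable N S /\ exists v w, same_pattern v w /\ S v /\ ~ S w.
  apply: NNPP => H; apply: H2 => S dS v w vw Sv; apply: NNPP => nSw.
  by apply: H; exists S; split=> //; exists v, w.
have [R R0 aS] := definable_agree dS; have [t st] := far_tuple 2 R.
have pair (u : 2.-tuple D) : [tuple tnth u ord0; tnth u ord_max] = u.
  apply: eq_from_tnth => i; rewrite (tnth_nth (thead u)) /=.
  case: i => [[|[|//]] i] /=; congr tnth; exact: val_inj.
have agree2 R' (u u' : 2.-tuple D) : pdist (tnth u ord0) (tnth u ord_max) =
    pdist (tnth u' ord0) (tnth u' ord_max) -> agree R' u u'.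
  move=> E i j; left.
  have o (a : 'I_2) : a = ord0 \/ a = ord_max.
    by case: a => [[|[|//]] a]; [left|right]; apply: val_inj.
  case: (o i) (o j) => -> [] ->; rewrite ?pdistxx // pdistC E; exact: pdistC.
have iv : tnth v ord0 <> tnth v ord_max.
  move=> E; apply: nSw; apply: (proj1 (aS v w _) Sv).
  by apply: agree2; rewrite E (proj1 (vw _ _) E) !pdistxx.
have iw : tnth w ord0 <> tnth w ord_max by move=> /vw.
have key (S' : 2.-tuple D -> Prop) u : definable N S' ->
    (forall v w, agree R v w -> S' v <-> S' w) ->
    ~ S' t -> S' u -> tnth u ord0 <> tnth u ord_max ->
    exists E R x y, [/\ definable2 N E, E x y & forall x y, E x y -> 0 < pdist x y <= R].
  move=> dS' aS' nSt Su iu; exists (fun x y => S' [tuple x; y] /\ x <> y), R.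
  exists (tnth u ord0), (tnth u ord_max); split.
  - apply: definable_and; last by apply/definable_not/definable_eq; projection.
    by apply: definable_ext dS' _ => a; rewrite pair.
  - by rewrite pair.
  move=> x y [Sxy /eqP]; rewrite -pdist_gt0 => -> /=; rewrite leqNgt; apply/negP => /ltnW far.
  apply/nSt/(proj1 (aS' _ _ _) Sxy) => i j; case: (eqVneq i j) => [->|ij].
    by left; rewrite !pdistxx.
  right; split; last exact: st.
  by case: i j ij => [[|[|//]] i] [[|[|//]] j] //= _; rewrite !(tnth_nth x) //= pdistC.
case: (classic (S t)) => St; last exact: (key S v).
apply: (key (fun u => ~ S u) w) => //; first exact: definable_not.
by move=> a b ab; have := aS a b ab; tauto.
Qed.

Lemma nontrivial_has_radius : ~ indiscernible 2 -> exists E M,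
  [/\ definable2 N E, has_radius E M, ~~ odd M & 2 <= M].
Proof.
move=> /nontrivial_binary[E [R [x [y [dE Exy ER]]]]]; exists E.
elim: R ER => [|R IH] ER; first by have := ER _ _ Exy; lia.
case: (classic (exists x y, E x y /\ pdist x y = R.+1)) => [[a [b [Eab ab]]]|H].
  exists R.+1; rewrite -ab; split=> //.
  - split=> c d; first by move=> cd; apply: definable2_dist dE (esym cd) Eab.
    by rewrite ab => /ER; lia.
  - exact: pdist_even.
  - have := pdist_even a b; have := ER _ _ Eab; case: (pdist a b) => [|[|]] //.
apply: IH => a b Eab; have := ER _ _ Eab; case: (eqVneq (pdist a b) R.+1) => [ab|]; last lia.
by case: H; exists a, b.
Qed.

(** After one round the distances are 2M and possibly 2M - 2. In the latter case a
    second round leaves 4M only, by [unique_mid_exact]. *)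
Lemma nontrivial_exact_distance : ~ indiscernible 2 -> exists E M,
  [/\ definable2 N E, forall x y, E x y <-> pdist x y = M, ~~ odd M & 4 <= M].
Proof.
move=> /nontrivial_has_radius[E [M [dE rE Mev M2]]].
have dE' := definable2_unique_mid dE; have rE' := unique_mid_has_radius Mev rE.
have Mev' : ~~ odd (2 * M) by rewrite mul2n odd_double.
case: (classic (exists x y, unique_mid E x y /\ pdist x y + 2 = 2 * M)) => [[a [b [Eab ab]]]|H].
  have dE'' := definable2_unique_mid dE'; have rE'' := unique_mid_has_radius Mev' rE'.
  exists (unique_mid (unique_mid E)), (2 * (2 * M)); split=> //; last lia; last first.
    by rewrite mul2n odd_double.
  move=> x y; split=> [um|]; last exact: (proj1 rE'').
  apply: unique_mid_exact um => //; first lia.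
  by move=> c d cd; apply: definable2_dist dE' _ Eab; lia.
exists (unique_mid E), (2 * M); split=> //; last lia.
move=> x y; split=> [um|]; last exact: (proj1 rE').
have ge := unique_mid_ge Mev rE um; have le := proj2 rE' _ _ um.
have := pdist_even x y; case: (eqVneq (pdist x y) (2 * M)) => // neq xy.
by case: H; exists x, y; split=> //; lia.
Qed.

(** [adjacent_iff], read as a formula in [E]. *)
Lemma exact_distance_improper E M : definable2 N E ->
  (forall x y, E x y <-> pdist x y = M) -> ~~ odd M -> 4 <= M -> improper (Gamma e A) N.
Proof.
move=> dE EM Mev M4; split=> [R|[]].
have H : definable2 N (fun x y => x <> y /\ forall w, w <> x ->
    (forall z, E x z -> E y z -> E w z) -> w = y).
  apply: definable_and; first by apply/definable_not/definable_eq; projection.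
  apply/definable_all/definable_imp; first by apply/definable_not/definable_eq; projection.
  apply: definable_imp; last by apply: definable_eq; projection.
  apply/definable_all/definable_imp; first by apply: definable2_app dE _ _; projection.
  by apply: definable_imp; apply: definable2_app dE _ _; projection.
apply: definable_ext H _ => v; rewrite /= at_distanceE.
rewrite -/(pdist (tnth v ord0) (tnth v ord_max)) (adjacent_iff _ _ Mev M4).
split=> -[xy H]; split=> // w wx sub; apply: H => // z.
  by move=> /EM xz /EM yz; apply/EM/sub.
by move=> xz yz; apply/EM/sub; apply/EM.
Qed.

End Reduct.

Lemma reduct_dichotomy (L : language) (N : structure L D) :
  definable_reduct (Gamma e A) N -> improper (Gamma e A) N \/ trivial_structure N.
Proof.
move=> red; case: (classic (indiscernible N 2)) => H2; [right|left].
  by apply: indiscernible_trivial => n; apply: indiscernible_all.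
have [E [M [dE EM Mev M4]]] := nontrivial_exact_distance red H2.
exact: exact_distance_improper dE EM Mev M4.
Qed.
End Tree.

(** * Absence of proper nontrivial reducts *)

Theorem theorem5p6 (k l : nat) (hk : 2 <= k) (hl : 3 <= l)
  (V : eqType) (e : rel V) (A : pred V) (hT : is_biregular_tree k l e A) :
  ~ exists (L' : language) (N' : structure L' {x : V | A x}),
      [/\ definable_reduct (Gamma e A) N',
          ~ improper (Gamma e A) N' &
          ~ trivial_structure N'].
Proof.
move=> [L' [N' [red nimp ntriv]]].
by case: (reduct_dichotomy hk hl hT red).
Qed.
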